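(* Let $l>0$, $m>0$, $W=lV\oplus mV^*$ and $U=U(GL)$. Consider the generating set $\mathcal M$ of ${\bf k}[W]^U$ consisting of the entries of $\overline{V^*}\,\overline V$, the lower minors of $\overline V$ of orders $1,\dots,\min\{l,n\}$, and the left minors of $\overline{V^*}$ of orders $1,\dots,\min\{m,n\}$. Then the ideal of all polynomial relations among the elements of $\mathcal M$ is generated by the relations among the lower minors of $\overline V$ alone (the Plücker and incidence relations) together with the relations among the left minors of $\overline{V^*}$ alone (the analogous Plücker and incidence relations) if and only if $l+m\le n$.
   Context: ${\bf k}$ algebraically closed of characteristic $0$; $V$ $n$-dimensional with basis $e_1,\dots,e_n$ and dual basis of $V^*$; $U(GL)$ the upper unitriangular matrices acting on $V$ and dually on $V^*$. $\overline V$ is the $n\times l$ matrix of coordinate functions on $lV$ ($(i,j)$ entry: $i$-th coordinate of the $j$-th vector); $\overline{V^*}$ is the $m\times n$ matrix of coordinate functions on $mV^*$ ($(i,j)$ entry: $j$-th coordinate of the $i$-th covector). A lower minor of order $k$ uses the last $k$ rows and any $k$ columns; a left minor of order $k$ uses the first $k$ columns and any $k$ rows. The ideal of relations is the kernel of the homomorphism from the polynomial ring with one variable per element of $\mathcal M$ to ${\bf k}[W]$; the relations among lower minors of $\overline V$ alone are those polynomials in the lower-minor variables lying in this kernel, similarly for $\overline{V^*}$. *)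

(* Defs.v *)
From HB Require Import structures.
From mathcomp Require Import all_boot all_order all_algebra.
From mathcomp Require Import mpoly.
From mathcomp Require Import zify.
Set Implicit Arguments. Unset Strict Implicit. Unset Printing Implicit Defensive.
Import GRing.Theory.
Local Open Scope ring_scope.

Definition ideal_gen (R : comNzRingType) (S : R -> Prop) (p : R) : Prop :=
  exists t : seq (R * R), (forall q, q \in t -> S q.2) /\
                          p = \sum_(q <- t) q.1 * q.2.

Definition only_vars (N : nat) (R : nzRingType) (P : pred 'I_N) (p : {mpoly R[N]}) :=
  forall mo, mo \in msupp p -> forall i, ~~ P i -> mo i = 0%N.

Section Setup.
Variables (k : fieldType) (n l m : nat).

(* k[W], W = lV (+) mV^*: n*l coordinates on lV, m*n coordinates on mV^* *)
Definition NW := (n * l + m * n)%N.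
Definition ringW := {mpoly k[NW]}.

(* \overline V : (i,j) entry = i-th coordinate of the j-th vector *)
Definition Vbar : 'M[ringW]_(n, l) :=
  \matrix_(i < n, j < l) 'X_(lshift (m * n) (mxvec_index i j)).
(* \overline{V^*} : (i,j) entry = j-th coordinate of the i-th covector *)
Definition Vsbar : 'M[ringW]_(m, n) :=
  \matrix_(i < m, j < n) 'X_(rshift (n * l) (mxvec_index i j)).

(* column sets for lower minors of Vbar, row sets for left minors of Vsbar:
   nonempty, of size at most n (so orders 1..min(l,n), resp. 1..min(m,n)) *)
Definition LowIdx := {S : {set 'I_l} | (0 < #|S|)%N && (#|S| <= n)%N}.
Definition LeftIdx := {S : {set 'I_m} | (0 < #|S|)%N && (#|S| <= n)%N}.

Lemma lastrow_proof (K : nat) (hK : (K <= n)%N) (i : 'I_K) : (n - K + i < n)%N.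
Proof. have := ltn_ord i; lia. Qed.

Definition lastrow (K : nat) (hK : (K <= n)%N) (i : 'I_K) : 'I_n :=
  Ordinal (lastrow_proof hK i).

Lemma LowIdx_le (T : LowIdx) : (#|val T| <= n)%N.
Proof. by case/andP: (valP T). Qed.
Lemma LeftIdx_le (T : LeftIdx) : (#|val T| <= n)%N.
Proof. by case/andP: (valP T). Qed.

Definition lower_minor (T : LowIdx) : ringW :=
  \det (\matrix_(i < #|val T|, j < #|val T|)
          Vbar (lastrow (LowIdx_le T) i) (enum_val j)).

Definition left_minor (T : LeftIdx) : ringW :=
  \det (\matrix_(i < #|val T|, j < #|val T|)
          Vsbar (enum_val i) (widen_ord (LeftIdx_le T) j)).

Definition GenIdx : finType := (('I_m * 'I_l) + (LowIdx + LeftIdx))%type.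

Definition gen (g : GenIdx) : ringW :=
  match g with
  | inl (i, j) => (Vsbar *m Vbar) i j
  | inr (inl T) => lower_minor T
  | inr (inr T) => left_minor T
  end.

Definition is_lower (g : GenIdx) : bool :=
  if g is inr (inl _) then true else false.
Definition is_left (g : GenIdx) : bool :=
  if g is inr (inr _) then true else false.

Definition NM := #|GenIdx|.
Definition ringM := {mpoly k[NM]}.

Definition evalM (p : ringM) : ringW :=
  comp_mpoly [tuple gen (enum_val i) | i < NM] p.

Definition lower_rel (p : ringM) : Prop :=
  only_vars (fun i : 'I_NM => is_lower (enum_val i)) p /\ evalM p = 0.
Definition left_rel (p : ringM) : Prop :=
  only_vars (fun i : 'I_NM => is_left (enum_val i)) p /\ evalM p = 0.

End Setup.

(* Main.v *)
(** Write [X] for [Vbar] and [Xi] for [Vsbar].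

    If [l + m <= n], the lower minors of [X] involve only its last [n - m]
    rows and the left minors of [Xi] only its first [m] columns [XiL].
    Specializing the other columns of [Xi] to [0] and the first [m] rows of
    [X] to [XiL^-1 Y] shows that any relation remains one when the entries of
    [Xi X] are replaced by independent variables [Y].  The three families of
    generators then live in disjoint sets of variables, and the kernel of a
    tensor product of algebra morphisms over a field is generated by the
    kernels of the factors; the morphism on the [Y] part is injective.

    If [n < l + m] and [n > 0], choose [a < l] and [b < m] with
    [n = a + b + 1].  A left minor of order [b + 1] and a lower minor of order
    [a + 1] share exactly one index, and their product is a signed sum of
    terms (entry of [Xi X]) * (left minor of order [b]) * (lower minor of
    order [a]).  Sending the variables of the entries of [Xi X] to [0] kills
    the relations among minors alone, but not this one.  For [n = 0] the
    entries of [Xi X] vanish, and sending their variables to [1] does the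
    job. *)

Require Import Defs.
From HB Require Import structures.
From mathcomp Require Import all_boot all_order all_algebra.
From mathcomp Require Import perm mpoly.
Local Open Scope ring_scope.
Set Implicit Arguments. Unset Strict Implicit. Unset Printing Implicit Defensive.
Import GRing.Theory.

(** * Ideals generated by a predicate *)

Section IdealGen.
Variables (R : comNzRingType) (S : R -> Prop).

Lemma ideal_gen_sub q : S q -> ideal_gen S q.
Proof.
move=> Sq; exists [:: (1, q)]; split; last by rewrite big_seq1 mul1r.
by move=> r /[!inE] /eqP->.
Qed.

Lemma ideal_gen0 : ideal_gen S 0.
Proof. by exists [::]; rewrite big_nil. Qed.

Lemma ideal_genD p q : ideal_gen S p -> ideal_gen S q -> ideal_gen S (p + q).
Proof.
move=> [s [Ss ->]] [t [St ->]]; exists (s ++ t); rewrite big_cat; split=> // r.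
by rewrite mem_cat => /orP[/Ss | /St].
Qed.

Lemma ideal_genMl a p : ideal_gen S p -> ideal_gen S (a * p).
Proof.
move=> [s [Ss ->]]; exists [seq (a * r.1, r.2) | r <- s].
split=> [_ /mapP[r /Ss Sr ->] // |].
by rewrite big_map mulr_sumr; apply: eq_bigr => r _ /=; rewrite mulrA.
Qed.

Lemma ideal_gen_sum (I : eqType) (s : seq I) (F : I -> R) :
  {in s, forall i, ideal_gen S (F i)} -> ideal_gen S (\sum_(i <- s) F i).
Proof.
move=> SF; rewrite big_seq; elim/big_ind: _ => //; first exact: ideal_gen0.
exact: ideal_genD.
Qed.

Lemma ideal_gen_ker (A : nzRingType) (f : {rmorphism R -> A}) p :
  (forall q, S q -> f q = 0) -> ideal_gen S p -> f p = 0.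
Proof.
move=> fS [s [Ss ->]]; rewrite rmorph_sum big_seq big1 // => q qs.
by rewrite rmorphM /= (fS q.2) ?mulr0 //; apply: Ss.
Qed.

End IdealGen.

Lemma ideal_gen_bind (R : comNzRingType) (S T : R -> Prop) p :
  (forall q, S q -> ideal_gen T q) -> ideal_gen S p -> ideal_gen T p.
Proof.
move=> ST [s [Ss ->]]; apply: ideal_gen_sum => r rs.
by apply/ideal_genMl/ST/Ss.
Qed.

(** * Polynomials in a subset of the variables *)

Section OnlyVars.
Variables (R : comNzRingType) (N : nat).
Implicit Types (P : pred 'I_N) (p q : {mpoly R[N]}).

Lemma only_varsD P p q : only_vars P p -> only_vars P q -> only_vars P (p + q).
Proof.
by move=> Pp Pq mo /msuppD_le; rewrite mem_cat => /orP[/Pp | /Pq].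
Qed.

Lemma only_varsZ P c p : only_vars P p -> only_vars P (c *: p).
Proof. by move=> Pp mo /msuppZ_le /Pp. Qed.

Lemma only_varsX P (mo : 'X_{1..N}) : (forall i, ~~ P i -> mo i = 0%N) ->
  only_vars P ('X_[mo] : {mpoly R[N]}).
Proof. by move=> Pmo mo'; rewrite msuppX inE => /eqP->. Qed.

Lemma only_vars_sum P (I : eqType) (s : seq I) (F : I -> {mpoly R[N]}) :
  {in s, forall i, only_vars P (F i)} -> only_vars P (\sum_(i <- s) F i).
Proof.
move=> PF; rewrite big_seq.
elim/big_ind: _ => // [mo|]; first by rewrite msupp0.
exact: only_varsD.
Qed.

Lemma rmorph_eq_only_vars (A : comNzRingType) P
    (f g : {rmorphism {mpoly R[N]} -> A}) p :
  only_vars P p -> (forall c, f c%:MP = g c%:MP) ->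
  (forall i, P i -> f 'X_i = g 'X_i) -> f p = g p.
Proof.
move=> Pp fgC fgX; rewrite [p]mpolyE !rmorph_sum big_seq [RHS]big_seq.
apply: eq_bigr => mo /Pp Pmo; rewrite -mul_mpolyC !rmorphM fgC.
congr (_ * _); rewrite mpolyXE_id !rmorph_prod; apply: eq_bigr => i _.
rewrite !rmorphXn; have [/fgX -> // | /Pmo ->] := boolP (P i).
by rewrite !expr0.
Qed.

(** Each monomial is cut in two. [P1] and [P2] may overlap; a variable in both goes to the first
    factor. *)
Lemma only_varsU_split P1 P2 p : only_vars (predU P1 P2) p ->
  exists s : seq ({mpoly R[N]} * {mpoly R[N]}),
    [/\ {in s, forall u, only_vars P1 u.1 /\ only_vars P2 u.2} &
        p = \sum_(u <- s) u.1 * u.2].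
Proof.
move=> Pp; pose m1 (mo : 'X_{1..N}) :=
  [multinom if P1 i then mo i else 0%N | i < N].
pose m2 (mo : 'X_{1..N}) := [multinom if P1 i then 0%N else mo i | i < N].
exists [seq (p@_mo *: 'X_[m1 mo], 'X_[m2 mo]) | mo <- msupp p]; split.
  move=> _ /mapP[mo /Pp Pmo ->]; split=> /=.
    by apply/only_varsZ/only_varsX => i /negPf nP1i; rewrite mnmE nP1i.
  apply: only_varsX => i /negPf nP2i; rewrite mnmE.
  case: ifPn => // /negPf nP1i.
  by apply: Pmo; rewrite /= nP1i nP2i.
rewrite big_map [LHS]mpolyE; apply: eq_bigr => mo _ /=.
rewrite -scalerAl -mpolyXD; congr (_ *: 'X_[_]); apply/mnmP => i.
by rewrite mnmDE !mnmE; case: ifP; rewrite ?addn0.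
Qed.

End OnlyVars.

(** * Kernel of a tensor product of algebra morphisms *)

(* [rho] separates variables: it sends the images of the variables in [S1] to
   coefficients and the images of those in [S2] to polynomials over the
   constants, which expresses that they involve disjoint sets of variables. *)
Section TensorKernel.
Variables (k : fieldType) (N G : nat).
Local Notation A := {mpoly k[N]}.
Variables (E : {rmorphism {mpoly k[G]} -> A}) (S1 S2 : pred 'I_G).
Variable rho : {rmorphism A -> {mpoly A[N]}}.
Hypothesis EC : forall c, E c%:MP = c%:MP.
Hypothesis rhoC : forall c, rho c%:MP = c%:MP%:MP.
Hypothesis rhoS1 : forall i, S1 i -> rho (E 'X_i) = (E 'X_i)%:MP.
Hypothesis rhoS2 :
  forall i, S2 i -> rho (E 'X_i) = map_mpoly (@mpolyC N k) (E 'X_i).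

Let K q := (only_vars S1 q /\ E q = 0) \/ (only_vars S2 q /\ E q = 0).

Let rhoE1 u : only_vars S1 u -> rho (E u) = (E u)%:MP.
Proof.
move=> S1u.
apply: (@rmorph_eq_only_vars _ _ _ _ (rho \o E) (@mpolyC N _ \o E) _ S1u)
  => [c|i /rhoS1 //] /=.
by rewrite !EC rhoC.
Qed.

Let rhoE2 u : only_vars S2 u -> rho (E u) = map_mpoly (@mpolyC N k) (E u).
Proof.
move=> S2u.
apply: (@rmorph_eq_only_vars _ _ _ _ (rho \o E)
  (map_mpoly (@mpolyC N k) \o E) _ S2u) => [c|i /rhoS2 //] /=.
by rewrite !EC rhoC map_mpolyC.
Qed.

(** Induction on the number of terms. If some [E u0.2] is nonzero, one of its coefficients yields a
    linear dependence over [k] among the [E u.1]; solving it for [E u0.1] removes the term [u0]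
    modulo the kernel on the [S1] variables. *)
Lemma tensor_kernel_sum (s : seq ({mpoly k[G]} * {mpoly k[G]})) :
  {in s, forall u, only_vars S1 u.1 /\ only_vars S2 u.2} ->
  \sum_(u <- s) E u.1 * E u.2 = 0 -> ideal_gen K (\sum_(u <- s) u.1 * u.2).
Proof.
elim: {s}(size s) {-2}s (leqnn (size s)) => [|d IHd] s les Ss Es0.
  by case: s les {Ss Es0} => // _; rewrite big_nil; apply: ideal_gen0.
have [allE|] := boolP (all (fun u => E u.2 == 0) s).
  apply: ideal_gen_sum => u us; apply/ideal_genMl/ideal_gen_sub; right.
  by split; [case: (Ss u us) | apply/eqP/(allP allE)].
case/allPn=> u0' u0's Eu0'.
have [u0 [u0s Eu0]] : exists u : {mpoly k[G]} * {mpoly k[G]},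
    u \in s /\ E u.2 != 0 by exists u0'.
have [mu c0] : exists mu, (E u0.2)@_mu != 0.
  by case: (msupp (E u0.2)) (mlead_supp Eu0) => // mu t _;
     exists (mlead (E u0.2)); rewrite mleadc_eq0.
pose c (u : {mpoly k[G]} * {mpoly k[G]}) := (E u.2)@_mu : k.
(* Under [rho] the factors [E u.1] become coefficients, so the coefficient at [mu] of the vanishing
   sum is this combination. *)
have sumc : \sum_(u <- s) c u *: E u.1 = 0.
  have := congr1 (fun q => (rho q)@_mu) Es0.
  rewrite rmorph0 mcoeff0 rmorph_sum raddf_sum => Emu.
  rewrite -[RHS]Emu.
  apply: eq_big_seq => u /Ss[S1u S2u].
  rewrite rmorphM /= rhoE1 // rhoE2 // mcoeffCM mcoeff_map_mpoly /=.
  by rewrite mulrC mul_mpolyC.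
have [s' [perm_s s's]] : exists s' : seq ({mpoly k[G]} * {mpoly k[G]}),
    perm_eq s (u0 :: s') /\ {subset s' <= s}.
  by exists (rem u0 s); split; [apply: perm_to_rem | apply: mem_rem].
rewrite (perm_big _ perm_s) big_cons /=.
(* Dividing [sumc] by [c u0] shows that [r] lies in the kernel of [E]. *)
pose r := u0.1 + \sum_(u <- s') (c u / c u0) *: u.1.
have S1r : only_vars S1 r.
  apply: only_varsD; first by case: (Ss _ u0s).
  by apply: only_vars_sum => u /s's /Ss[S1u _]; apply: only_varsZ.
have Er : E r = 0.
  have EZ a q : E (a *: q) = a *: E q by rewrite -!mul_mpolyC rmorphM EC.
  rewrite -[RHS](scaler0 _ (c u0)^-1) -sumc (perm_big _ perm_s) big_cons /=.
  rewrite scalerDr scalerA mulVf // scale1r rmorphD rmorph_sum scaler_sumr.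
  by congr (_ + _); apply: eq_bigr => u _; rewrite EZ scalerA mulrC.
(* Substituting [r] for [u0.1] changes the second factors and leaves one term fewer. *)
pose t := [seq (u.1, u.2 - (c u / c u0) *: u0.2) | u <- s'].
have sumE: u0.1 * u0.2 + \sum_(u <- s') u.1 * u.2
    = u0.2 * r + \sum_(u <- t) u.1 * u.2.
  rewrite big_map mulrDr [u0.1 * _]mulrC -addrA; congr (_ + _).
  rewrite mulr_sumr -big_split /=; apply: eq_bigr => u _.
  by rewrite mulrBr -scalerAr -scalerAr [u0.2 * _]mulrC addrC subrK.
rewrite sumE; apply: ideal_genD.
  by apply/ideal_genMl/ideal_gen_sub; left.
apply: IHd.
- by rewrite size_map -ltnS (leq_trans _ les) // (perm_size perm_s).
- move=> _ /mapP[u /s's us ->] /=; have [? ?] := Ss _ us; split=> //.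
  rewrite -scaleNr; apply/only_varsD/only_varsZ => //.
  by case: (Ss _ u0s).
have Es : E (\sum_(u <- s) u.1 * u.2) = 0.
  by rewrite rmorph_sum -[RHS]Es0; apply: eq_bigr => u _; rewrite rmorphM.
move: Es; rewrite (perm_big _ perm_s) big_cons /= sumE.
rewrite rmorphD rmorphM Er mulr0 add0r => Et.
rewrite -[RHS]Et rmorph_sum.
by  apply: eq_bigr => u _; rewrite rmorphM.
Qed.

Lemma tensor_kernel p : only_vars (predU S1 S2) p -> E p = 0 -> ideal_gen K p.
Proof.
move=> /only_varsU_split[s [Ss ->]] Ep0; apply: tensor_kernel_sum => //.
by rewrite -[RHS]Ep0 rmorph_sum; apply: eq_bigr => u _; rewrite rmorphM.
Qed.

End TensorKernel.

(** * Evaluation of the generators, and points of [W] *)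

Section Evaluation.
Variables (k : fieldType) (n l m : nat).
Local Notation ringW := (ringW k n l m).
Local Notation ringM := (ringM k n l m).
Local Notation GenIdx := (GenIdx n l m).
Local Notation Vbar := (Vbar k n l m).
Local Notation Vsbar := (Vsbar k n l m).

(** The minors are kept while the entries of [Vsbar *m Vbar] are replaced by an arbitrary [h];
    relations among minors alone do not see [h]. *)
Definition genY (h : 'I_m -> 'I_l -> ringW) (g : GenIdx) : ringW :=
  match g with
  | inl (i, j) => h i j
  | inr (inl T) => lower_minor k m T
  | inr (inr T) => left_minor k l T
  end.

Definition evalY (h : 'I_m -> 'I_l -> ringW) : {rmorphism ringM -> ringW} :=
  comp_mpoly [tuple genY h (enum_val i) | i < NM n l m].

Lemma evalYXi h i : evalY h 'X_i = genY h (enum_val i).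
Proof. by rewrite [LHS]comp_mpolyXU -tnth_nth tnth_mktuple. Qed.

Lemma evalYX h g : evalY h 'X_(enum_rank g) = genY h g.
Proof. by rewrite evalYXi enum_rankK. Qed.

Lemma evalYC h c : evalY h c%:MP = c%:MP.
Proof. exact: comp_mpolyC. Qed.

Lemma evalM_evalY p : evalM p = evalY (Vsbar *m Vbar) p.
Proof. by []. Qed.

Definition is_Y (g : GenIdx) : bool := if g is inl _ then true else false.

Lemma evalY_only_vars h h' p :
  only_vars (fun i : 'I_(NM n l m) => ~~ is_Y (enum_val i)) p ->
  evalY h p = evalY h' p.
Proof.
move=> pP; apply: (rmorph_eq_only_vars pP) => [c|i].
  by rewrite !evalYC.
by rewrite !evalYXi; case: (enum_val i) => [[]|[]].
Qed.

Section Point.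
Variables (R : comNzRingType) (f : {rmorphism k -> R}).
Variables (X : 'M[R]_(n, l)) (Xi : 'M[R]_(m, n)).

Definition ev : {rmorphism ringW -> R} :=
  mmap f (fun i => row_mx (mxvec X) (mxvec Xi) ord0 i).

Lemma evC c : ev c%:MP = f c.
Proof. exact: mmapC. Qed.

Lemma ev_Vbar i j : ev (Vbar i j) = X i j.
Proof.
by rewrite mxE [LHS]mmapX mmap1U row_mxEl mxvecE.
Qed.

Lemma ev_Vsbar i j : ev (Vsbar i j) = Xi i j.
Proof.
by rewrite mxE [LHS]mmapX mmap1U row_mxEr mxvecE.
Qed.

Lemma ev_mulmx i j : ev ((Vsbar *m Vbar) i j) = (Xi *m X) i j.
Proof.
rewrite !mxE rmorph_sum; apply: eq_bigr => a _.
by rewrite rmorphM /= ev_Vbar ev_Vsbar.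
Qed.

Lemma ev_lower_minor (T : LowIdx n l) : ev (lower_minor k m T)
  = \det (\matrix_(i, j) X (lastrow (LowIdx_le T) i) (enum_val j)).
Proof.
rewrite /lower_minor -det_map_mx; congr (\det _).
by apply/matrixP => i j; rewrite !mxE -ev_Vbar mxE.
Qed.

Lemma ev_left_minor (T : LeftIdx n m) : ev (left_minor k l T)
  = \det (\matrix_(i, j) Xi (enum_val i) (widen_ord (LeftIdx_le T) j)).
Proof.
rewrite /left_minor -det_map_mx; congr (\det _).
by apply/matrixP => i j; rewrite !mxE -ev_Vsbar mxE.
Qed.

End Point.

End Evaluation.

#[local] Opaque evalY ev.

(** * Minors with rows or columns listed in any order *)

Lemma det_reindex_row (R : comNzRingType) K K' (eK : K = K') (s : 'I_K -> 'I_K)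
    (F : 'I_K -> 'I_K -> R) (F' : 'I_K' -> 'I_K' -> R) :
  injective s ->
  (forall i j, F i j = F' (cast_ord eK (s i)) (cast_ord eK j)) ->
  exists b : bool, \det (\matrix_(i, j) F i j) =
    (-1) ^+ b * \det (\matrix_(i, j) F' i j).
Proof.
case: K' / eK F' => F' sI FF'; exists (perm sI).
rewrite -det_perm -det_mulmx -row_permE; congr (\det _).
by apply/matrixP => i j; rewrite !mxE FF' !cast_ord_id permE.
Qed.

Section MinorPolynomials.
Variables (k : fieldType) (n l m : nat).
Local Notation Vbar := (Vbar k n l m).
Local Notation Vsbar := (Vsbar k n l m).

(** Up to sign this is the generator indexed by the image of [f], or the constant 1 in order 0,
    where there is no generator. One [q] serves every [h], so it can be evaluated at several [h]. *)
Lemma left_minor_poly K (hK : (K <= n)%N) (f : 'I_K -> 'I_m) :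
  injective f -> exists q : ringM k n l m, forall h,
    evalY h q = \det (\matrix_(i, j) Vsbar (f i) (widen_ord hK j)).
Proof.
move=> fI; case: K => [|K] in hK f fI *.
  by exists 1 => h; rewrite rmorph1 det_mx00.
pose A := f @: 'I_K.+1.
have cA : #|A| = K.+1 by rewrite card_imset // card_ord.
have hA : (0 < #|A|)%N && (#|A| <= n)%N by rewrite cA.
pose T : LeftIdx n m := Sub A hA.
have fA i : f i \in A by apply: imset_f.
pose s i := cast_ord cA (enum_rank_in (fA ord0) (f i)).
have sI : injective s.
  move=> i j /cast_ord_inj /(congr1 enum_val).
  by rewrite !enum_rankK_in // => /fI.
have [|b detE] := det_reindex_row (F := fun i j => Vsbar (f i) (widen_ord hK j))
  (F' := fun i j => Vsbar (@enum_val _ (mem (val T)) i)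
                          (widen_ord (LeftIdx_le T) j)) (eK := esym cA) sI.
  move=> i j; rewrite /s cast_ordK enum_rankK_in //.
  by congr (Vsbar _ _); apply: val_inj.
exists ((-1) ^+ b * 'X_(enum_rank (inr (inr T)))) => h.
by rewrite rmorphM rmorph_sign evalYX detE.
Qed.

(** As for left minors, after transposing, since here the columns are reordered. *)
Lemma lower_minor_poly K (hK : (K <= n)%N) (f : 'I_K -> 'I_l) :
  injective f -> exists q : ringM k n l m, forall h,
    evalY h q = \det (\matrix_(i, j) Vbar (lastrow hK i) (f j)).
Proof.
move=> fI; case: K => [|K] in hK f fI *.
  by exists 1 => h; rewrite rmorph1 det_mx00.
pose A := f @: 'I_K.+1.
have cA : #|A| = K.+1 by rewrite card_imset // card_ord.
have hA : (0 < #|A|)%N && (#|A| <= n)%N by rewrite cA.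
pose T : LowIdx n l := Sub A hA.
have fA i : f i \in A by apply: imset_f.
pose s i := cast_ord cA (enum_rank_in (fA ord0) (f i)).
have sI : injective s.
  move=> i j /cast_ord_inj /(congr1 enum_val).
  by rewrite !enum_rankK_in // => /fI.
have [|b detE] := det_reindex_row (F := fun j i => Vbar (lastrow hK i) (f j))
  (F' := fun j i => Vbar (lastrow (LowIdx_le T) i)
                         (@enum_val _ (mem (val T)) j)) (eK := esym cA) sI.
  move=> i j; rewrite /s cast_ordK enum_rankK_in //.
  by congr (Vbar _ _); apply: val_inj; rewrite /= cA.
exists ((-1) ^+ b * 'X_(enum_rank (inr (inl T)))) => h.
rewrite rmorphM rmorph_sign evalYX /= -[RHS]det_tr /lower_minor -[in LHS]det_tr.
have trE K' (F : 'I_K' -> 'I_K' -> ringW k n l m) :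
    (\matrix_(i, j) F i j)^T = \matrix_(i, j) F j i.
  by apply/matrixP => i j; rewrite !mxE.
by rewrite !trE detE.
Qed.

End MinorPolynomials.

(** * The case [l + m <= n], with [n] written as [m + q] *)

Section Disjoint.
Variables (k : fieldType) (l m q : nat).
Hypothesis le_lq : (l <= q)%N.
Local Notation n := (m + q)%N.
Local Notation ringW := (ringW k n l m).
Local Notation ringM := (ringM k n l m).
Local Notation Vbar := (Vbar k n l m : 'M_(m + q, l)).
Local Notation Vsbar := (Vsbar k n l m : 'M_(m, m + q)).

Let top : 'I_m -> 'I_l -> ringW := usubmx Vbar.

Lemma col_mx_lastrow (R : nzRingType) (A B : 'M[R]_(_, l)) K
    (hK : (K <= n)%N) i j :
  (K <= q)%N ->
  col_mx A (dsubmx (B : 'M_(m + q, l))) (lastrow hK i) j = B (lastrow hK i) j.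
Proof.
move=> le_Kq.
have ltiq : (q - K + i < q)%N by rewrite -ltn_subRL subKn.
have -> : lastrow hK i = rshift m (Ordinal ltiq).
  by apply: val_inj; rewrite /= -addnBA // addnA.
by rewrite col_mxEd mxE.
Qed.

Lemma row_mx_widen (R : nzRingType) (A B : 'M[R]_(m, _)) K
    (hK : (K <= n)%N) i j :
  (K <= m)%N ->
  row_mx (lsubmx (A : 'M_(m, m + q))) B i (widen_ord hK j)
    = A i (widen_ord hK j).
Proof.
move=> le_Km.
have -> : widen_ord hK j = lshift q (widen_ord le_Km j) by apply: val_inj.
by rewrite row_mxEl mxE.
Qed.

Section MinorImages.
Variables (R : comNzRingType).
Variables (f : {rmorphism k -> R}) (g : {rmorphism ringW -> R}).
Variables (X : 'M[R]_(m, l)) (Xi : 'M[R]_(m, q)).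

(** A lower minor has order at most [l <= q], so its rows avoid the top block [X], which is
    therefore arbitrary. *)
Lemma ev_bottom_lower_minor Xi' T :
  ev f (col_mx X (dsubmx (map_mx g Vbar))) Xi' (lower_minor k m T)
    = g (lower_minor k m T).
Proof.
rewrite ev_lower_minor /lower_minor -det_map_mx; congr (\det _).
apply/matrixP => i j; rewrite mxE col_mx_lastrow ?mxE //.
by apply: leq_trans (max_card _) _; rewrite card_ord.
Qed.

Lemma ev_left_left_minor X' T :
  ev f X' (row_mx (lsubmx (map_mx g Vsbar)) Xi) (left_minor k l T)
    = g (left_minor k l T).
Proof.
rewrite ev_left_minor /left_minor -det_map_mx; congr (\det _).
apply/matrixP => i j; rewrite mxE row_mx_widen ?mxE //.
by apply: leq_trans (max_card _) _; rewrite card_ord.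
Qed.

End MinorImages.

#[local] Opaque lower_minor left_minor.

Lemma det_left_Vsbar_neq0 : \det (lsubmx Vsbar) != 0.
Proof.
(* At the point where [Vsbar] is the identity followed by zero columns, the determinant is 1. *)
pose e := ev (n := m + q) (idfun : {rmorphism k -> k}) (0 : 'M_(m + q, l))
    (row_mx 1%:M 0 : 'M_(m, m + q)).
have : e (\det (lsubmx Vsbar)) != 0.
  rewrite -det_map_mx; have -> : map_mx e (lsubmx Vsbar) = 1%:M.
    by apply/matrixP => i j; rewrite mxE [lsubmx _ _ _]mxE
      [LHS]ev_Vsbar row_mxEl.
  by rewrite det1 oner_neq0.
by apply: contraNneq => ->; rewrite rmorph0.
Qed.

(* Over the fraction field, put [usubmx Vbar := XiL^-1 *m Y] and let the last
   [q] columns of [Vsbar] vanish: then [Vsbar *m Vbar] becomes [Y] while the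
   minors, which involve only the last [q] rows of [Vbar] and the first [m]
   columns of [Vsbar], are unchanged. *)
Lemma evalM_eq0_top (p : ringM) : evalM p = 0 -> evalY top p = 0.
Proof.
pose F := {fraction ringW}.
pose g : {rmorphism ringW -> F} := @FracField.tofrac ringW.
pose XiL : 'M[F]_m := lsubmx (map_mx g Vsbar).
pose Xtop : 'M[F]_(m, l) := invmx XiL *m map_mx g (usubmx Vbar).
pose e := ev (n := m + q) (g \o @mpolyC _ k : {rmorphism k -> F})
  (col_mx Xtop (dsubmx (map_mx g Vbar))) (row_mx XiL 0).
have XiLu : XiL \in unitmx.
  rewrite unitmxE unitfE /XiL -map_lsubmx det_map_mx tofrac_eq0.
  exact: det_left_Vsbar_neq0.
have eE : e (evalM p) = g (evalY top p).
  rewrite evalM_evalY.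
  have pT : only_vars predT p by [].
  apply: (rmorph_eq_only_vars (f := e \o evalY (Vsbar *m Vbar))
    (g := g \o evalY top) pT) => [c|i _] /=.
    by rewrite !evalYC [LHS]evC.
  rewrite !evalYXi; case: (enum_val i) => [[a b]|[T|T]] /=.
  - rewrite [LHS]ev_mulmx mul_row_col mul0mx addr0 mulmxA mulmxV // mul1mx.
    by rewrite mxE.
  - exact: ev_bottom_lower_minor.
  - exact: ev_left_left_minor.
move=> p0; apply/eqP; rewrite -tofrac_eq0; apply/eqP.
by rewrite -[RHS](rmorph0 e) -p0; apply/esym.
Qed.

(** Two copies of [k[W]] in its tensor square: [inner] as coefficients, [outer] as polynomials with
    constant coefficients. *)
Let inner : {rmorphism ringW -> {mpoly ringW[NW n l m]}} := @mpolyC _ _.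
Let outer : {rmorphism ringW -> {mpoly ringW[NW n l m]}} :=
  map_mpoly (@mpolyC _ k).
Let cst : {rmorphism k -> {mpoly ringW[NW n l m]}} :=
  @mpolyC _ _ \o @mpolyC _ k.

Let Alow (i : 'I_(NM n l m)) := is_lower (enum_val i).
Let Bleft (i : 'I_(NM n l m)) := Defs.is_left (enum_val i).
Let Yprod (i : 'I_(NM n l m)) := is_Y (enum_val i).

(** The entries of [top] are distinct variables; [back] sends each to the generator it came from. *)
Lemma evalY_top_inj v : only_vars Yprod v -> evalY top v = 0 -> v = 0.
Proof.
pose X : 'M[ringM]_(m, l) := \matrix_(i, j) 'X_(enum_rank (inl (i, j))).
pose back := ev (n := m + q) (@mpolyC _ k : {rmorphism k -> ringM})
  (col_mx X 0) (0 : 'M_(m, m + q)).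
move=> Yv v0; rewrite -[RHS](rmorph0 back) -v0; apply/esym.
apply: (@rmorph_eq_only_vars _ _ _ _ (back \o evalY top) idfun _ Yv).
  by move=> c /=; rewrite evalYC [LHS]evC.
move=> i; rewrite /Yprod /= evalYXi; case Ei: (enum_val i) => [[a b]|[]] // _.
by rewrite /= /top mxE [LHS]ev_Vbar col_mxEu mxE -Ei enum_valK.
Qed.

(** [tensor_kernel] is applied twice: first to split off the lower minors, then to separate the left
    minors from the entries of [top]. *)
Lemma evalY_top_kernel (p : ringM) : evalY top p = 0 ->
  ideal_gen (fun r => lower_rel r \/ left_rel r) p.
Proof.
have nY (P : pred 'I_(NM n l m)) r : (forall i, P i -> ~~ Yprod i) ->
    only_vars P r -> evalY top r = evalM r.
  move=> PY Pr; rewrite evalM_evalY; apply: evalY_only_vars => mo mo_r i ni.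
  by apply: Pr => //; apply: contra ni; apply: PY.
move=> p0.
have /ideal_gen_bind : ideal_gen (fun r =>
    (only_vars Alow r /\ evalY top r = 0)
    \/ (only_vars (predU Bleft Yprod) r /\ evalY top r = 0)) p.
  (* Only the bottom rows of [Vbar], which carry the lower minors, go to the coefficient copy. *)
  pose rho := ev (n := m + q) cst
    (col_mx (usubmx (map_mx outer Vbar)) (dsubmx (map_mx inner Vbar)))
    (map_mx outer Vsbar : 'M_(m, m + q)).
  have rhoC c : rho c%:MP = c%:MP%:MP by rewrite [LHS]evC.
  have rhoA i : Alow i -> rho (evalY top 'X_i) = (evalY top 'X_i)%:MP.
    rewrite /Alow evalYXi.
    case: (enum_val i) => [[a b]|[T|T]] Ai;
      [discriminate Ai | | discriminate Ai].
    by rewrite [LHS](ev_bottom_lower_minor cst inner).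
  have rhoBY i : predU Bleft Yprod i ->
      rho (evalY top 'X_i) = map_mpoly (@mpolyC _ k) (evalY top 'X_i).
    rewrite /Bleft /Yprod [predU _ _ _]/= evalYXi.
    case: (enum_val i) => [[a b]|[T|T]] BYi; [|discriminate BYi|].
      by rewrite [genY _ _]/= /top mxE [LHS]ev_Vbar col_mxEu !mxE.
    rewrite /rho -[map_mx outer Vsbar]hsubmxK.
    by rewrite [LHS](ev_left_left_minor cst outer).
  apply: (tensor_kernel (evalYC top) rhoC rhoA rhoBY) p0 => mo _ i.
  rewrite /= /Alow /Bleft /Yprod.
  by case: (enum_val i) => [[]|[]].
apply=> r [[Ar r0]|[BYr r0]].
  apply: ideal_gen_sub; left; split=> //; rewrite -(nY Alow) // => i.
  by rewrite /Alow /Yprod; case: (enum_val i) => [[]|[]].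
have /ideal_gen_bind : ideal_gen (fun r =>
    (only_vars Bleft r /\ evalY top r = 0)
    \/ (only_vars Yprod r /\ evalY top r = 0)) r.
  (* Now [Vsbar], which carries the left minors, goes to the coefficient copy. *)
  pose rho := ev (n := m + q) cst (map_mx outer Vbar : 'M_(m + q, l))
    (map_mx inner Vsbar : 'M_(m, m + q)).
  have rhoC c : rho c%:MP = c%:MP%:MP by rewrite [LHS]evC.
  have rhoB i : Bleft i -> rho (evalY top 'X_i) = (evalY top 'X_i)%:MP.
    rewrite /Bleft evalYXi.
    case: (enum_val i) => [[a b]|[T|T]] Bi;
      [discriminate Bi | discriminate Bi |].
    rewrite /rho -[map_mx inner Vsbar]hsubmxK.
    by rewrite [LHS](ev_left_left_minor cst inner).
  have rhoY i : Yprod i ->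
      rho (evalY top 'X_i) = map_mpoly (@mpolyC _ k) (evalY top 'X_i).
    rewrite /Yprod evalYXi.
    case: (enum_val i) => [[a b]|[T|T]] Yi; [|discriminate Yi|discriminate Yi].
    by rewrite [genY _ _]/= /top mxE [LHS]ev_Vbar mxE.
  exact: (tensor_kernel (evalYC top) rhoC rhoB rhoY) BYr r0.
apply=> s [[Bs s0]|[Ys s0]].
  apply: ideal_gen_sub; right; split=> //; rewrite -(nY Bleft) // => i.
  by rewrite /Bleft /Yprod; case: (enum_val i) => [[]|[]].
by rewrite (evalY_top_inj Ys s0); apply: ideal_gen0.
Qed.

End Disjoint.

(** * Product of a left and a lower minor sharing one index *)

Section MinorProduct.
Variables (R : comNzRingType) (n l m a b : nat).
Hypothesis nE : n = (b + a).+1.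
Variables (X : 'M[R]_(n, l)) (Xi : 'M[R]_(m, n)).
Variables (f : 'I_b.+1 -> 'I_m) (g : 'I_a.+1 -> 'I_l).
Variables (hb : (b <= n)%N) (hb1 : (b < n)%N).
Variables (ha : (a <= n)%N) (ha1 : (a < n)%N).

(** The shared index is [b]: at [c = b], [D] is the left minor of order [b.+1] and [N] the lower
    minor of order [a.+1]. For any other [c] one of them has a repeated column or row. *)
Let D (c : 'I_n) : R :=
  \det (\matrix_(i, j < b.+1) Xi (f i)
                               (if j < b then widen_ord hb1 j else c)%N).

Let N (c : 'I_n) : R :=
  \det (\matrix_(i, j < a.+1) X (if i == ord0 then c else lastrow ha1 i) (g j)).

Let D_expand c : D c = \sum_(i < b.+1) (-1) ^+ (i + b) * Xi (f i) c *
  \det (\matrix_(i', j') Xi (f (lift i i')) (widen_ord hb j')).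
Proof.
rewrite /D (expand_det_col _ ord_max); apply: eq_bigr => i _.
rewrite mxE ltnn /cofactor /= mulrA [Xi _ _ * _]mulrC; congr (_ * \det _).
apply/matrixP => i' j'; rewrite !mxE lift_max ltn_ord.
by congr (Xi _ _); apply: val_inj; rewrite /= /bump leqNgt ltn_ord.
Qed.

Let N_expand c : N c = \sum_(j < a.+1) (-1) ^+ j * X c (g j) *
  \det (\matrix_(i', j') X (lastrow ha i') (g (lift j j'))).
Proof.
rewrite /N (expand_det_row _ ord0); apply: eq_bigr => j _.
rewrite mxE eqxx /cofactor /= mulrA [X _ _ * _]mulrC; congr (_ * \det _).
apply/matrixP => i' j'; rewrite !mxE /=.
by congr (X _ _); apply: val_inj; rewrite /= /bump /= add1n addnS -addSn -subSn.
Qed.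

Let D_lt (c : 'I_n) : (c < b)%N -> D c = 0.
Proof.
move=> lt_cb; rewrite /D -det_tr.
apply: (determinant_alternate (i1 := Ordinal (ltnW lt_cb : (c < b.+1)%N))
                              (i2 := ord_max)) => [|i].
  by rewrite -val_eqE /= ltn_eqF.
rewrite !mxE /= lt_cb ltnn; congr (Xi _ _); exact: val_inj.
Qed.

Let N_gt (c : 'I_n) : (b < c)%N -> N c = 0.
Proof.
move=> lt_bc; have lt_i : (c - b < a.+1)%N.
  by rewrite ltn_subLR ?(ltnW lt_bc) // addnS -nE.
have ne0 : Ordinal lt_i != ord0 by rewrite -val_eqE /= -lt0n subn_gt0.
rewrite /N; apply: (determinant_alternate ne0) => j.
rewrite !mxE (negPf ne0) eqxx; congr (X _ _); apply: val_inj.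
by rewrite /= {1}nE subSS addnK subnKC // ltnW.
Qed.

(* Both sides are the sum over [c] of [D c * N c]; on the right only the one
   column of [Xi], i.e. row of [X], shared by the two minors contributes. *)
Lemma minor_product :
  \sum_(i < b.+1) \sum_(j < a.+1)
    (-1) ^+ (i + b) * (-1) ^+ j * (Xi *m X) (f i) (g j) *
    (\det (\matrix_(i', j') Xi (f (lift i i')) (widen_ord hb j')) *
     \det (\matrix_(i', j') X (lastrow ha i') (g (lift j j')))) =
  \det (\matrix_(i, j) Xi (f i) (widen_ord hb1 j)) *
  \det (\matrix_(i, j) X (lastrow ha1 i) (g j)).
Proof.
transitivity (\sum_(c < n) D c * N c).
  under [RHS]eq_bigr => c _ do rewrite D_expand N_expand big_distrlr /=.
  rewrite [RHS]exchange_big /=; apply: eq_bigr => i _.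
  rewrite [RHS]exchange_big /=; apply: eq_bigr => j _.
  rewrite mxE mulr_sumr mulr_suml; apply: eq_bigr => c _.
  by rewrite [RHS]mulrACA; congr (_ * _); rewrite [RHS]mulrACA.
rewrite (bigD1 (Ordinal hb1)) //= [X in _ + X]big1 ?addr0 => [|c].
  congr (_ * _); congr (\det _); apply/matrixP => i j; rewrite !mxE.
    congr (Xi _ _); case: ltnP => // le_bj; apply: val_inj => /=.
    by apply/eqP; rewrite eqn_leq le_bj -ltnS ltn_ord.
  congr (X _ _); case: eqP => // ->; apply: val_inj.
  by rewrite /= {1}nE subSS addnK addn0.
rewrite -val_eqE /= neq_ltn => /orP[/D_lt -> | /N_gt ->].
  by rewrite mul0r.
by rewrite mulr0.
Qed.

End MinorProduct.

(** * The case [n < l + m] *)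

Section Overlap.
Variables (k : fieldType) (n l m : nat).
Local Notation ringM := (ringM k n l m).
Local Notation Vbar := (Vbar k n l m).
Local Notation Vsbar := (Vsbar k n l m).

Lemma left_minor_neq0 K (hK : (K <= n)%N) (hm : (K <= m)%N) :
  \det (\matrix_(i, j) Vsbar (widen_ord hm i) (widen_ord hK j)) != 0.
Proof.
pose e := ev (idfun : {rmorphism k -> k}) (0 : 'M_(n, l))
  (\matrix_(i < m, j < n) (i == j :> nat)%:R).
have: e (\det (\matrix_(i, j) Vsbar (widen_ord hm i) (widen_ord hK j))) != 0.
  rewrite -det_map_mx [X in \det X](_ : _ = 1%:M) ?det1 ?oner_neq0 //.
  by apply/matrixP => i j; rewrite mxE [X in e X]mxE [LHS]ev_Vsbar !mxE.
by apply: contraNneq => ->; rewrite rmorph0.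
Qed.

Lemma lower_minor_neq0 K (hK : (K <= n)%N) (hl : (K <= l)%N) :
  \det (\matrix_(i, j) Vbar (lastrow hK i) (widen_ord hl j)) != 0.
Proof.
pose e := ev (idfun : {rmorphism k -> k})
  (\matrix_(i < n, j < l) (i == n - K + j :> nat)%N%:R) (0 : 'M_(m, n)).
have: e (\det (\matrix_(i, j) Vbar (lastrow hK i) (widen_ord hl j))) != 0.
  rewrite -det_map_mx [X in \det X](_ : _ = 1%:M) ?det1 ?oner_neq0 //.
  apply/matrixP => i j; rewrite mxE [X in e X]mxE [LHS]ev_Vbar !mxE /=.
  by rewrite eqn_add2l.
by apply: contraNneq => ->; rewrite rmorph0.
Qed.

(** This is the obstruction: the generating relations vanish for every [h], so a relation that fails
    for some [h] is not generated by them. *)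
Lemma evalY_ideal h (p : ringM) :
  ideal_gen (fun r => lower_rel r \/ left_rel r) p -> evalY h p = 0.
Proof.
apply: ideal_gen_ker => r [[Pr r0]|[Pr r0]]; rewrite -[RHS]r0 evalM_evalY;
  apply: evalY_only_vars => mo mo_r i ni; apply: (Pr mo mo_r);
  by apply: contra ni; case: (enum_val i) => [[]|[]].
Qed.

Lemma evalM_ideal (p : ringM) :
  ideal_gen (fun r => lower_rel r \/ left_rel r) p -> evalM p = 0.
Proof. by rewrite evalM_evalY; apply: evalY_ideal. Qed.

Lemma overlap_relation a b : n = (b + a).+1 -> (a < l)%N -> (b < m)%N ->
  exists p : ringM, evalM p = 0 /\ evalY (fun _ _ => 0) p != 0.
Proof.
move=> nE lt_al lt_bm.
have hb1 : (b < n)%N by rewrite nE ltnS leq_addr.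
have ha1 : (a < n)%N by rewrite nE ltnS leq_addl.
pose f := widen_ord lt_bm; pose g := widen_ord lt_al.
have fI : injective f by move=> i j /(congr1 val) ij; apply: val_inj.
have gI : injective g by move=> i j /(congr1 val) ij; apply: val_inj.
have /fin_all_exists[qL qLE] i :=
  left_minor_poly k l (ltnW hb1) (inj_comp fI (@lift_inj _ i)).
have /fin_all_exists[qD qDE] j :=
  lower_minor_poly k m (ltnW ha1) (inj_comp gI (@lift_inj _ j)).
have [qL1 qL1E] := left_minor_poly k l hb1 fI.
have [qD1 qD1E] := lower_minor_poly k m ha1 gI.
(* [minor_product] lifted to [ringM]; at [h = 0] only the product of two nonzero minors survives. *)
pose p : ringM := \sum_(i < b.+1) \sum_(j < a.+1)
  (-1) ^+ (i + b) * (-1) ^+ j * 'X_(enum_rank (inl (f i, g j)))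
  * (qL i * qD j) - qL1 * qD1.
have pE h : evalY h p = \sum_(i < b.+1) \sum_(j < a.+1)
    (-1) ^+ (i + b) * (-1) ^+ j * h (f i) (g j) *
    (\det (\matrix_(i', j') Vsbar (f (lift i i')) (widen_ord (ltnW hb1) j')) *
     \det (\matrix_(i', j') Vbar (lastrow (ltnW ha1) i') (g (lift j j')))) -
    \det (\matrix_(i, j) Vsbar (f i) (widen_ord hb1 j)) *
    \det (\matrix_(i, j) Vbar (lastrow ha1 i) (g j)).
  rewrite rmorphB rmorphM qL1E qD1E; congr (_ - _).
  rewrite rmorph_sum; apply: eq_bigr => i _.
  rewrite rmorph_sum; apply: eq_bigr => j _.
  by rewrite !rmorphM !rmorph_sign evalYX qLE qDE.
exists p; split.
  by rewrite evalM_evalY pE minor_product // subrr.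
rewrite pE big1 => [|i _]; last by rewrite big1 // => j _; rewrite mulr0 mul0r.
by rewrite sub0r oppr_eq0 mulf_neq0 ?left_minor_neq0 ?lower_minor_neq0.
Qed.

Lemma overlap_not_generated : (0 < l)%N -> (0 < m)%N -> (n < l + m)%N ->
  exists p : ringM,
    evalM p = 0 /\ ~ ideal_gen (fun r => lower_rel r \/ left_rel r) p.
Proof.
move=> l_gt0 m_gt0 lt_n_lm; have [n0|n_gt0] := posnP n.
  (* For [n = 0] an entry of the product is an empty sum, so its variable is itself a relation. *)
  exists 'X_(enum_rank (inl (Ordinal m_gt0, Ordinal l_gt0))); split.
    rewrite evalM_evalY evalYX /= mxE big1 // => i.
    by have := ltn_ord i; rewrite {2}n0.
  move=> /(evalY_ideal (fun _ _ => 1)) /eqP.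
  by rewrite evalYX oner_eq0.
have [p [p0 np0]] : exists p : ringM,
    evalM p = 0 /\ evalY (fun _ _ => 0) p != 0.
  (* Take [a] as large as possible: [l.-1] if [l <= n], otherwise [n.-1]; then [b] is forced. *)
  have [le_ln|lt_nl] := leqP l n.
    apply: (@overlap_relation l.-1 (n - l)); last by rewrite ltn_subLR.
      by rewrite -addnS prednK // subnK.
    by rewrite prednK.
  apply: (@overlap_relation n.-1 0) => //; first by rewrite add0n prednK.
  by rewrite prednK // ltnW.
exists p; split=> // /(evalY_ideal (fun _ _ => 0)) p0'.
by rewrite p0' eqxx in np0.
Qed.

End Overlap.

(** * The equivalence *)

Unset Implicit Arguments.

Theorem theorem4 (k : closedFieldType) (hchar : [pchar k] =i pred0)
  (n l m : nat) (hl : (0 < l)%N) (hm : (0 < m)%N) :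
  (forall p : ringM k n l m,
     evalM p = 0 <->
     ideal_gen (fun q => lower_rel q \/ left_rel q) p)
  <-> (l + m <= n)%N.
Proof.
split=> [kerE | le_lm_n p].
  rewrite leqNgt; apply/negP => /(overlap_not_generated k hl hm)[p [p0 not_p]].
  by apply: not_p; apply/kerE.
split; last exact: evalM_ideal.
have le_mn : (m <= n)%N := leq_trans (leq_addl l m) le_lm_n.
have le_lq : (l <= n - m)%N by rewrite leq_subRL // addnC.
(* Writing [n] as [m + (n - m)] gives the block decompositions of [Vbar] and [Vsbar]. *)
move: p; rewrite -(subnKC le_mn) => p p0.
exact: evalY_top_kernel le_lq _ (evalM_eq0_top le_lq p0).
Qed.
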